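(* Consider an infinite-horizon Markov decision process with state space $\mathcal S$, action space $\mathcal A$, transition density $q$, a stationary target policy $\pi$ and discount factor $0\le\gamma<1$. Assume: (i) the Markov property holds with transition density $q$; (ii) the batch data, consisting of $N$ i.i.d. trajectories $\{(S_{i,t},A_{i,t},R_{i,t},S_{i,t+1})\}_{0\le t<T}$, are generated by a stationary behavior policy $\pi^b$; (iii) there are positive constants $p_{\min},p_{1,\max},p_{2,\max}$ such that $p_{\min}\le \bar d^{\pi^b}_T(s,a)\le p_{1,\max}$ for all $(s,a)\in\mathcal S\times\mathcal A$, $\pi$ is absolutely continuous with respect to $\pi^b$, and $q^\pi(s',a'\mid s,a)\le p_{2,\max}$ for all $s,a,s',a'$. Let $p_{\max}=\max(p_{1,\max},p_{2,\max})$. Then for any two functions $Q_1,Q_2$ on $\mathcal S\times\mathcal A$ that are square integrable with respect to $\bar d^{\pi^b}_T$, $$\sqrt{\frac{p_{\min}}{p_{\max}}}\,(1-\gamma)\,\|Q_1-Q_2\|_{2,\bar d^{\pi^b}_T}\le \|\mathcal T h^\pi(Q_1-Q_2)\|_{2,\bar d^{\pi^b}_T}\le \|h^\pi(Q_1-Q_2)\|_{2,\bar d^{\pi^b}_T\times q}.$$ In particular, the $L^2$-measure of ill-posedness satisfies $$\overline\tau\lesssim \frac{\sqrt{p_{\max}\big(1+\frac{p_{\max}\gamma^2}{p_{\min}}\big)}}{\sqrt{p_{\min}}\,(1-\gamma)}\lesssim 1 .$$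
   Context: $\pi(a\mid s)$ and $\pi^b(a\mid s)$ denote the action densities of the target and behavior policies. $q_t^{\pi^b}(s,a)$ is the marginal density of $(S_t,A_t)$ under $\pi^b$, and $\bar d^{\pi^b}_T(s,a)=\frac1T\sum_{t=0}^{T-1}q_t^{\pi^b}(s,a)$ is the average visitation density. $q^\pi(s',a'\mid s,a)=q(s'\mid s,a)\pi(a'\mid s')$ is the one-step state-action transition density under $\pi$. For a function $Q$, $h^\pi(Q)(s,a,s')=Q(s,a)-\gamma\int_{\mathcal A}\pi(a'\mid s')Q(s',a')\,da'$. $\mathcal T f(s,a)=\mathbb E[f(S,A,S')\mid S=s,A=a]$ with $S'\mid(S,A)=(s,a)$ having density $q(\cdot\mid s,a)$. $\|\cdot\|_{2,\nu}$ is the $L^2$ norm under the distribution $\nu$; $L^2(S,A)$ is taken under $\bar d^{\pi^b}_T$ and $L^2(S,A,S')$ under $\bar d^{\pi^b}_T\times q$. The $L^2$-measure of ill-posedness is $\overline\tau=\sup_{Q\in L^2(S,A)}\|h^\pi(Q)\|_{L^2(S,A,S')}/\|\mathcal T h^\pi(Q)\|_{L^2(S,A)}$. The notation $a\lesssim b$ means $a\le Cb$ for a constant $C$. *)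

(* Defs.v *)
From HB Require Import structures.
From mathcomp Require Import all_boot all_order all_algebra.
From mathcomp Require Import all_classical all_reals all_analysis.
Set Implicit Arguments. Unset Strict Implicit. Unset Printing Implicit Defensive.
Import Order.TTheory GRing.Theory Num.Theory.
Import numFieldNormedType.Exports.
Local Open Scope classical_set_scope.
Local Open Scope ring_scope.

(* Infinite-horizon MDP with state space S and action space A.  All
   densities are taken w.r.t. sigma-finite reference measures muS on S and
   muA on A (e.g. Lebesgue or counting measure); state-action densities are
   w.r.t. the product measure muS \x muA on S * A. *)
Section MDP.
Context {R : realType} {dS dA : measure_display}
  {S : measurableType dS} {A : measurableType dA}.
Variables (muS : {sigma_finite_measure set S -> \bar R})
          (muA : {sigma_finite_measure set A -> \bar R}).

Local Open Scope ereal_scope.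

Definition muSA := (muS \x muA).

Definition is_state_density (rho : S -> R) : Prop :=
  measurable_fun setT rho /\ (forall s, (0 <= rho s)%R) /\
  \int[muS]_s (rho s)%:E = 1.

Definition is_policy (pi : S -> A -> R) : Prop :=
  measurable_fun setT (fun z : S * A => pi z.1 z.2) /\
  forall s, (forall a, (0 <= pi s a)%R) /\ \int[muA]_a (pi s a)%:E = 1.

Definition is_transition (q : S -> A -> S -> R) : Prop :=
  measurable_fun setT (fun x : (S * A) * S => q x.1.1 x.1.2 x.2) /\
  forall s a, (forall s', (0 <= q s a s')%R) /\ \int[muS]_s' (q s a s')%:E = 1.

Definition policy_abs_cont (pi pib : S -> A -> R) : Prop :=
  forall s (B : set A), measurable B ->
    \int[muA]_(a in B) (pib s a)%:E = 0 -> \int[muA]_(a in B) (pi s a)%:E = 0.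

(* q_t^{pib}: marginal density of (S_t, A_t) under the behaviour policy pib,
   initial density rho and transition density q (Markov property). *)
Fixpoint marg (rho : S -> R) (q : S -> A -> S -> R) (pib : S -> A -> R)
    (t : nat) : S * A -> \bar R :=
  match t with
  | 0%N => fun z => (rho z.1 * pib z.1 z.2)%:E
  | t'.+1 => fun z =>
      (\int[muSA]_y (marg rho q pib t' y * (q y.1 y.2 z.1)%:E)) *
      (pib z.1 z.2)%:E
  end.

Definition dbar rho q pib (T : nat) (z : S * A) : \bar R :=
  ((T%:R)^-1)%:E * \sum_(t < T) marg rho q pib t z.

Definition hpi (pi : S -> A -> R) (gamma : R) (Q : S * A -> R)
    (x : (S * A) * S) : \bar R :=
  (Q x.1)%:E - gamma%:E * \int[muA]_a' (pi x.2 a' * Q (x.2, a'))%:E.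

(* (T f)(s,a) = E[f(S,A,S') | S = s, A = a] *)
Definition Top (q : S -> A -> S -> R) (f : (S * A) * S -> \bar R)
    (z : S * A) : \bar R :=
  \int[muS]_s' ((q z.1 z.2 s')%:E * f (z, s')).

Definition norm_SA (d : S * A -> \bar R) (g : S * A -> \bar R) : \bar R :=
  sqrte (\int[muSA]_z (d z * g z ^+ 2)).

Definition norm_SAS (d : S * A -> \bar R) (q : S -> A -> S -> R)
    (f : (S * A) * S -> \bar R) : \bar R :=
  sqrte (\int[muSA]_z (d z * \int[muS]_s' ((q z.1 z.2 s')%:E * f (z, s') ^+ 2))).

Definition L2_SA (d : S * A -> \bar R) (Q : S * A -> R) : Prop :=
  measurable_fun setT Q /\ \int[muSA]_z (d z * (Q z)%:E ^+ 2) < +oo.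

Definition ill_posedness rho q pi pib T gamma : \bar R :=
  ereal_sup ((fun Q => norm_SAS (dbar rho q pib T) q (hpi pi gamma Q) /
                         norm_SA (dbar rho q pib T) (Top q (hpi pi gamma Q)))
             @` L2_SA (dbar rho q pib T)).

Definition MDP_assumptions (rho : S -> R) (q : S -> A -> S -> R)
    (pi pib : S -> A -> R) (T : nat) (gamma pmin p1max p2max : R) : Prop :=
  [/\ (0 <= gamma < 1)%R /\ (0 < T)%N,
      [/\ is_state_density rho, is_transition q, is_policy pi & is_policy pib],
      (0 < pmin)%R /\ (0 < p1max)%R /\ (0 < p2max)%R,
      (forall z, (pmin%:E <= dbar rho q pib T z) /\ (dbar rho q pib T z <= p1max%:E)) &
      policy_abs_cont pi pib /\
      (forall s a s' a', (q s a s' * pi s' a' <= p2max)%R)].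

End MDP.

(* Main.v *)
Require Import Defs.
From HB Require Import structures.
From mathcomp Require Import all_boot all_order all_algebra.
From mathcomp Require Import all_classical all_reals all_analysis.
From mathcomp Require Import measurable_realfun ring lra.
Import Order.TTheory GRing.Theory Num.Theory.
Local Open Scope ring_scope.

(** Write [P] for the operator with density [q^pi], and [g = Q - gamma P Q], which
is [T h^pi(Q)].  The bound [q^pi <= p_2max] and Cauchy-Schwarz make [P] map
[L^2(dbar)] to bounded functions, with [sup |P f| <= sqrt (p_2max / p_min) ||f||].
Applying [P] to [Q = g + gamma P Q] gives
[sup |P Q| <= sup |P g| + gamma sup |P Q|], hence
[sup |P Q| <= sqrt (p_2max / p_min) ||g|| / (1 - gamma)].  Convexity of the square,
[Q^2 <= g^2 / (1 - gamma) + gamma (P Q)^2], integrated against the probability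
density [dbar], then gives the lower bound.  The upper bound is Jensen's inequality
for [q(. | s, a)], and the ill-posedness bound follows from
[||h^pi(Q)||^2 <= 2 (1 + gamma^2 p_max / p_min) ||Q||^2]. *)

(** * Extended-real squares and a contraction estimate *)

Lemma sqre_abse {R : realDomainType} (x : \bar R) : (`|x| ^+ 2 = x ^+ 2)%E.
Proof.
by case: x => [r| |]; rewrite !expe2 // -!EFinM -!normrM ger0_norm ?sqr_ge0.
Qed.

Lemma measurable_sqre {d} {T : measurableType d} {R : realType} {D : set T}
    {f : T -> \bar R} :
  measurable_fun D f -> measurable_fun D (fun x => f x ^+ 2)%E.
Proof.
move=> mf; under eq_fun do rewrite expe2; exact: emeasurable_funM.
Qed.

(** Let [M] be the supremum of [|f|]. The a priori bound makes it a genuine real supremum, so [step]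
    applies to [M] itself, and [M <= c + g * M] is solved for [M] since [g < 1]. *)
Lemma le_of_contraction {T : Type} {R : realType} {f : T -> R} {c g : R} :
  g < 1 -> (exists M, forall x, `|f x| <= M) ->
  (forall M, (forall x, `|f x| <= M) -> forall x, `|f x| <= c + g * M) ->
  forall x, `|f x| <= c / (1 - g).
Proof.
move=> g1 [M0 fM0] step x.
pose M := sup (range (fun x => `|f x|)).
have fM y : `|f y| <= M.
  apply: ub_le_sup; last by exists y.
  by exists M0 => _ [z _ <-].
have : M <= c + g * M.
  apply: ge_sup; first by exists `|f x|, x.
  by move=> _ [z _ <-]; exact: step.
move=> h; apply: (le_trans (fM x)).
by rewrite ler_pdivlMr ?subr_gt0//; lra.
Qed.

(** * Integration without integrability hypotheses, and Jensen's inequality for the square *)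

Section integral_complements.
Context {d} {T : measurableType d} {R : realType}.
Context (mu : {measure set T -> \bar R}).
Local Open Scope ereal_scope.

(** A nonnegative scalar commutes with the positive and negative parts, so each part can be scaled
    separately. The equality survives infinite parts, including [+oo - +oo], by inspection of cases
    when [0 < r]. *)
Lemma integralZl_nneg (r : R) (f : T -> \bar R) :
  (0 <= r)%R -> measurable_fun setT f ->
  \int[mu]_x (r%:E * f x) = r%:E * \int[mu]_x f x.
Proof.
rewrite le_eqVlt => /predU1P[<- _|r0 mf].
  by rewrite mul0e; apply: integral0_eq => x _; rewrite mul0e.
have mp := measurable_funepos mf; have mn := measurable_funeneg mf.
rewrite [LHS]integralE [in RHS]integralE.
have -> : (fun x => r%:E * f x)^\+ = (fun x => r%:E * f^\+ x).
  by rewrite ge0_funeposM// ltW.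
have -> : (fun x => r%:E * f x)^\- = (fun x => r%:E * f^\- x).
  by rewrite ge0_funenegM// ltW.
rewrite !ge0_integralZl ?lee_fin ?(ltW r0)//.
have : 0 <= \int[mu]_x f^\- x by exact: integral_ge0.
have : 0 <= \int[mu]_x f^\+ x by exact: integral_ge0.
move: (integral _ _ _) (integral _ _ _) => [a| |] [b| |] // a0 b0.
- by rewrite -!EFinB -!EFinM mulrBr.
all: by rewrite ?(gt0_muley, gt0_muleNy) ?lte_fin//=
       ?(gt0_muley, gt0_muleNy) ?lte_fin.
Qed.

(** Over an empty type every integral is 0. Total mass 1 thus provides a point at which pointwise
    bounds yield inequalities between constants. *)
Lemma inhabited_of_integral (f : T -> \bar R) :
  \int[mu]_x f x != 0 -> inhabited T.
Proof.
apply: contra_neqP => nT; apply: integral0_eq => x _.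
by case: nT; exact: inhabits.
Qed.

(** Jensen's inequality by tangents: with [m] the integral of [p |f|], integrating
    [2 m y <= y^2 + m^2] at [y = |f x|] against the density [p] leaves [m^2 <= B]. If [B] is
    infinite there is nothing to prove, so [f] may be any measurable extended-real function. *)
Lemma sqr_integral_density_le (p : T -> R) (f : T -> \bar R) :
  measurable_fun setT p -> (forall x, (0 <= p x)%R) ->
  \int[mu]_x (p x)%:E = 1 -> measurable_fun setT f ->
  (\int[mu]_x ((p x)%:E * f x)) ^+ 2 <= \int[mu]_x ((p x)%:E * f x ^+ 2).
Proof.
move=> mp p0 p1 mf.
have mpE : measurable_fun setT (EFin \o p) by exact/measurable_EFinP.
have maf : measurable_fun setT (fun x => `|f x|) by exact: measurableT_comp.
have mpf : measurable_fun setT (fun x => (p x)%:E * `|f x|).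
  exact: emeasurable_funM.
have mpf2 : measurable_fun setT (fun x => (p x)%:E * f x ^+ 2).
  by apply: emeasurable_funM => //; exact: measurable_sqre.
have pf0 x : 0 <= (p x)%:E * `|f x| by rewrite mule_ge0 ?lee_fin.
have pf20 x : 0 <= (p x)%:E * f x ^+ 2 by rewrite mule_ge0 ?lee_fin ?sqre_ge0.
set B := \int[mu]_x ((p x)%:E * f x ^+ 2).
have B0 : 0 <= B by exact: integral_ge0.
pose m := \int[mu]_x ((p x)%:E * `|f x|).
have m0 : 0 <= m by exact: integral_ge0.
have abs_le : `|\int[mu]_x ((p x)%:E * f x)| <= m.
  apply: (le_trans (le_abse_integral _ _ _)) => //.
    exact: emeasurable_funM.
  rewrite /m le_eqVlt; apply/orP; left; apply/eqP; apply: eq_integral => x _.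
  by rewrite abseM gee0_abs ?lee_fin.
rewrite -sqre_abse.
apply: (@le_trans _ _ (m ^+ 2)); first by rewrite lee_sqr.
(* Used with [(a, c) = (1, 1)] to see that [m] is finite, then with
   [(2 m, m ^+ 2)], which is [m ^+ 2 <= B]. *)
have aff (a c : R) : (0 <= a)%R -> (0 <= c)%R ->
    (forall y, 0 <= y -> a * y <= y ^+ 2 + c)%R -> a%:E * m <= B + c%:E.
  move=> a0 c0 ac.
  rewrite -ge0_integralZl ?lee_fin//.
  rewrite -[c%:E]mule1 -p1 -ge0_integralZl ?lee_fin//; last first.
    by move=> x _; rewrite lee_fin.
  rewrite -ge0_integralD//; last 2 first.
    by move=> x _; rewrite mule_ge0 ?lee_fin.
    exact: measurable_funeM.
  apply: ge0_le_integral => //.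
  - by move=> x _; rewrite mule_ge0 ?lee_fin.
  - exact: measurable_funeM.
  - by apply: emeasurable_funD => //; exact: measurable_funeM.
  move=> x _.
  rewrite [c%:E * _]muleC -ge0_muleDr ?sqre_ge0 ?lee_fin//.
  rewrite muleCA lee_wpmul2l ?lee_fin//.
  rewrite -sqre_abse; case: (f x) => [r| |]; rewrite ?leey//=.
  by rewrite -!EFinM lee_fin ac.
case: (eqVneq B +oo) => [->|Boo]; first by rewrite leey.
have Bfin : B \is a fin_num by rewrite ge0_fin_numE// ltey.
have mfin : m \is a fin_num.
  rewrite ge0_fin_numE//.
  apply: (@le_lt_trans _ _ (B + 1%:E)).
    by rewrite -[m]mul1e; apply: aff => // y y0; nra.
  by rewrite -(fineK Bfin) -EFinD ltry.
have [r rE] : exists r, m = r%:E by exists (fine m); rewrite fineK.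
have [b bE] : exists b, B = b%:E by exists (fine B); rewrite fineK.
have := @aff (2 * r)%R (r ^+ 2)%R.
move: m0; rewrite rE bE expe2 -!EFinM -EFinD !lee_fin => r0 h.
have {}h : (2 * r * r <= b + r ^+ 2)%R.
  by apply: h; [lra|exact: sqr_ge0|move=> y _; have := sqr_ge0 (y - r); lra].
by nra.
Qed.

End integral_complements.

(** Tonelli gives measurability for the positive and the negative part; the difference is then
    measurable even where both are infinite. *)
Lemma measurable_integral_section {d1 d2} {T1 : measurableType d1}
    {T2 : measurableType d2} {R : realType}
    (m2 : {sigma_finite_measure set T2 -> \bar R}) (f : T1 * T2 -> \bar R) :
  measurable_fun setT f ->
  measurable_fun setT (fun x => \int[m2]_y f (x, y))%E.
Proof.
move=> mf; under eq_fun do rewrite integralE.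
apply: emeasurable_funB.
- rewrite (_ : (fun x => _) = fubini_F m2 (f^\+)%E); last first.
    by apply/funext => x; apply: eq_integral => y _; rewrite !funeposE.
  apply: measurable_fun_fubini_tonelli_F => //; exact: measurable_funepos.
- rewrite (_ : (fun x => _) = fubini_F m2 (f^\-)%E); last first.
    by apply/funext => x; apply: eq_integral => y _; rewrite !funenegE.
  apply: measurable_fun_fubini_tonelli_F => //; exact: measurable_funeneg.
Qed.

(** * Averaging operators with a bounded kernel density, and their resolvent *)

Section kernel_density.
Context {d} {X : measurableType d} {R : realType}.
Context (mu : {sigma_finite_measure set X -> \bar R}).
Context (k : X * X -> R) (w : X -> \bar R) (lo p : R).
Context (mk : measurable_fun setT k) (k0 : forall z, 0 <= k z).
Context (k1 : forall x, (\int[mu]_y (k (x, y))%:E = 1)%E).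
Context (kp : forall z, k z <= p).
Context (mw : measurable_fun setT w) (w1 : (\int[mu]_x w x = 1)%E).
Context (lo0 : 0 < lo) (low : forall x, (lo%:E <= w x)%E).
Local Open Scope ereal_scope.

Let w0 x : 0 <= w x.
Proof. by apply: le_trans (low x); rewrite lee_fin ltW. Qed.

(** The sign of [p] is read off from [0 <= k (x, x) <= p], which is why a point is an argument. *)
Let ratio_ge0 (x : X) : (0 <= p / lo)%R.
Proof. by rewrite divr_ge0 ?(ltW lo0)// (le_trans (k0 (x, x))). Qed.

Let mkx x : measurable_fun setT (fun y => (k (x, y))).
Proof. exact: measurable_fun_pair2. Qed.

Definition kernel_avg (Q : X -> R) (x : X) : \bar R :=
  \int[mu]_y (k (x, y) * Q y)%:E.

(** Change of measure: pointwise [k <= p = (p / lo) * lo <= (p / lo) * w]. *)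
Lemma integral_kernel_le (x : X) (f : X -> \bar R) :
  measurable_fun setT f -> (forall y, 0 <= f y) ->
  \int[mu]_y ((k (x, y))%:E * f y) <= (p / lo)%:E * \int[mu]_y (w y * f y).
Proof.
move=> mf f0.
have plo0 := ratio_ge0 x.
rewrite -ge0_integralZl//; last 2 first.
  exact: emeasurable_funM.
  by move=> y _; rewrite mule_ge0.
apply: ge0_le_integral => //.
- by move=> y _; rewrite mule_ge0 ?lee_fin.
- by apply: emeasurable_funM => //; exact/measurable_EFinP.
- by apply: measurable_funeM; exact: emeasurable_funM.
move=> y _; rewrite muleA lee_wpmul2r//.
apply: (@le_trans _ _ ((p / lo)%:E * lo%:E)); last by rewrite lee_wpmul2l.
by rewrite -EFinM divfK ?gt_eqF// lee_fin.
Qed.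

(** Jensen for the density [k (x, .)], then the change of measure. The right side does not depend on
    [x], so averages of [L^2(w)] functions are bounded. *)
Lemma kernel_avg_sqr_le (Q : X -> R) (x : X) : measurable_fun setT Q ->
  kernel_avg Q x ^+ 2 <= (p / lo)%:E * \int[mu]_y (w y * (Q y)%:E ^+ 2).
Proof.
move=> mQ; have mQE : measurable_fun setT (EFin \o Q) by exact/measurable_EFinP.
apply: (@le_trans _ _ (\int[mu]_y ((k (x, y))%:E * (Q y)%:E ^+ 2))); last first.
  apply: integral_kernel_le; first exact: measurable_sqre.
  by move=> y; rewrite sqre_ge0.
exact: (sqr_integral_density_le mu (fun y => k (x, y)) (EFin \o Q)).
Qed.

(** The preceding bound applied to [|Q|] makes the square of the integral of [k |Q|] finite, hence
    the integral itself. *)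
Lemma integrable_kernel_avg (Q : X -> R) (x : X) : measurable_fun setT Q ->
  \int[mu]_y (w y * (Q y)%:E ^+ 2) < +oo ->
  mu.-integrable setT (fun y => (k (x, y) * Q y)%:E).
Proof.
move=> mQ Qoo; apply/integrableP; split.
  by apply/measurable_EFinP; exact: measurable_funM.
have mnQ : measurable_fun setT (fun y => `|Q y|%R) by exact: measurableT_comp.
have := kernel_avg_sqr_le _ x mnQ.
rewrite (eq_integral (fun y => w y * (Q y)%:E ^+ 2)); last first.
  by move=> y _; rewrite -abse_EFin sqre_abse.
rewrite /kernel_avg (eq_integral (fun y => `|(k (x, y) * Q y)%:E|)
  (fun y => (k (x, y) * `|Q y|)%:E)); last first.
  by move=> y _; rewrite abse_EFin normrM (ger0_norm (k0 _)).
move=> h; have {h} : (\int[mu]_y `|(k (x, y) * Q y)%:E|) ^+ 2 < +oo.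
  by apply: (le_lt_trans h); rewrite lte_mul_pinfty// lee_fin ratio_ge0.
by case: (integral _ _ _) => [r| |]//; rewrite ?ltry.
Qed.

Lemma kernel_avg_fin (Q : X -> R) (x : X) : measurable_fun setT Q ->
  \int[mu]_y (w y * (Q y)%:E ^+ 2) < +oo -> kernel_avg Q x \is a fin_num.
Proof.
by move=> mQ Qoo; apply: integrable_fin_num => //; exact: integrable_kernel_avg.
Qed.

Lemma measurable_kernel_avg (Q : X -> R) : measurable_fun setT Q ->
  measurable_fun setT (kernel_avg Q).
Proof.
move=> mQ.
apply: (measurable_integral_section mu (fun z => (k z * Q z.2)%:E)).
apply/measurable_EFinP; apply: measurable_funM => //.
exact: measurableT_comp.
Qed.

(** The constant [K] has two tasks: [p / lo <= K] controls the supremum of the average, and [1 <= K]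
    absorbs the remaining multiple of the squared norm at the end. *)
Lemma resolvent_bound (Q : X -> R) (g K : R) :
  (0 <= g < 1)%R -> (1 <= K)%R -> (p / lo <= K)%R -> measurable_fun setT Q ->
  \int[mu]_x (w x * (Q x)%:E ^+ 2) < +oo ->
  ((1 - g) ^+ 2)%:E * \int[mu]_x (w x * (Q x)%:E ^+ 2) <=
  K%:E * \int[mu]_x (w x * (Q x - g * fine (kernel_avg Q x))%:E ^+ 2).
Proof.
move=> /andP[g0 g1] K1 pK mQ Qoo.
pose B x := fine (kernel_avg Q x).
have BE x : (B x)%:E = kernel_avg Q x by rewrite fineK// kernel_avg_fin.
pose h x := (Q x - g * B x)%R.
have mB : measurable_fun setT B.
  by apply: measurableT_comp (measurable_kernel_avg _ mQ) => //.
have mh : measurable_fun setT h.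
  by apply: measurable_funB => //; exact: measurable_funM.
have mQE : measurable_fun setT (fun x => w x * (Q x)%:E ^+ 2).
  apply: emeasurable_funM => //; apply: measurable_sqre.
  exact/measurable_EFinP.
have mhE : measurable_fun setT (fun x => w x * (h x)%:E ^+ 2).
  apply: emeasurable_funM => //; apply: measurable_sqre.
  exact/measurable_EFinP.
have mE0 (f : X -> R) x : 0 <= w x * (f x)%:E ^+ 2.
  by rewrite mule_ge0 ?sqre_ge0.
rewrite -/(fun x => w x * (h x)%:E ^+ 2).
set H := \int[mu]_x (w x * (h x)%:E ^+ 2).
have H0 : 0 <= H by exact: integral_ge0.
have [->|Hoo] := eqVneq H +oo.
  by rewrite gt0_muley ?leey// lte_fin (lt_le_trans ltr01).
have [r rE] : exists r, H = r%:E.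
  by exists (fine H); rewrite fineK// ge0_fin_numE// ltey.
have r0 : (0 <= r)%R by rewrite -lee_fin -rE.
have Hlt : H < +oo by rewrite ltey.
(* This is the uniform bound on the average of [h], whose squared norm is [r]. *)
pose c := Num.sqrt (p / lo * r).
have p0 : (0 <= p / lo)%R.
  have [x] : inhabited X.
    by apply: (inhabited_of_integral mu w); rewrite w1 oner_neq0.
  exact: ratio_ge0 x.
have bound (f : X -> R) x M : measurable_fun setT f ->
    \int[mu]_x (w x * (f x)%:E ^+ 2) = M%:E ->
    (`|fine (kernel_avg f x)| <= Num.sqrt (p / lo * M))%R.
  move=> mf fM.
  have : kernel_avg f x \is a fin_num.
    by apply: kernel_avg_fin => //; rewrite fM ltry.
  have := kernel_avg_sqr_le _ x mf.
  rewrite fM; move: (kernel_avg f x) => [s| |]//.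
  rewrite expe2 -!EFinM lee_fin /= -expr2 => sM _.
  by rewrite -sqrtr_sqr ler_wsqrtr.
have BM x : (`|B x| <= c / (1 - g))%R.
  move: x; apply: le_of_contraction => //.
    (* The a priori bound on [B] comes from the finite norm of [Q]; its size disappears from the
       conclusion. *)
    exists (Num.sqrt (p / lo * fine (\int[mu]_x (w x * (Q x)%:E ^+ 2)))) => x.
    apply: bound => //; rewrite fineK// ge0_fin_numE//; exact: integral_ge0.
  move=> M BM x.
  have iB : mu.-integrable setT (fun y => (k (x, y) * B y)%:E).
    apply: (@le_integrable _ _ _ mu setT _ _
      (fun y => M%:E * (k (x, y))%:E)) => //.
    - by apply/measurable_EFinP; exact: measurable_funM.
    - move=> y _; rewrite -EFinM !abse_EFin lee_fin !normrM mulrC.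
      by rewrite ler_wpM2r// (le_trans (BM y))// ler_norm.
    - apply: integrableZl => //; apply/integrableP; split.
        exact/measurable_EFinP.
      under eq_integral do rewrite gee0_abs ?lee_fin//.
      by rewrite k1 ltry.
  have ih : mu.-integrable setT (fun y => (k (x, y) * h y)%:E).
    exact: integrable_kernel_avg.
  (* Average the identity [Q = h + g * B]. Both terms are integrable: [h] has finite norm and [B] is
     bounded. *)
  have e : (B x)%:E = kernel_avg h x + g%:E * kernel_avg B x.
    rewrite BE /kernel_avg -integralZl// -integralD//; last exact: integrableZl.
    apply: eq_integral => y _; rewrite -EFinM -EFinD; congr (_%:E).
    by rewrite /h; ring.
  have kBM : `|kernel_avg B x| <= M%:E.
    apply: (le_trans (le_abse_integral _ _ _)) => //.
      exact: (measurable_int mu).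
    rewrite -[leRHS]mule1 -(k1 x) -ge0_integralZl//; last 3 first.
    - exact/measurable_EFinP.
    - by move=> y _; rewrite lee_fin.
    - by rewrite lee_fin (le_trans _ (BM x)).
    apply: ge0_le_integral => //.
    - by apply: measurableT_comp => //; exact: (measurable_int mu).
    - by apply: measurable_funeM; exact/measurable_EFinP.
    move=> y _; rewrite -EFinM abse_EFin lee_fin normrM (ger0_norm (k0 _)) mulrC.
    by rewrite ler_wpM2r.
  have := bound h x r mh rE; rewrite -/c.
  have : kernel_avg h x \is a fin_num by exact: kernel_avg_fin.
  move: e kBM; move: (kernel_avg h x) (kernel_avg B x) => [a| |]// [b| |]//.
  rewrite -EFinM -EFinD => -[->] /=; rewrite lee_fin => bM _ ac.
  by rewrite (le_trans (ler_normD _ _))// lerD// normrM (ger0_norm g0) ler_wpM2l.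
(* Convexity of the square for [Q = (1 - g) * (h / (1 - g)) + g * B], multiplied by [(1 - g)^2] to
   clear denominators. The gap in the inequality is exactly [g (1 - g) (h - (1 - g) B)^2]. *)
have pw x : ((1 - g) ^+ 2 * Q x ^+ 2 <= (1 - g) * h x ^+ 2 + g * (K * r))%R.
  have Bc : ((1 - g) ^+ 2 * B x ^+ 2 <= K * r)%R.
    apply: (@le_trans _ _ (c ^+ 2)%R).
      rewrite -exprMn -real_normK ?num_real// ler_sqr ?nnegrE ?sqrtr_ge0//.
      rewrite normrM gtr0_norm ?subr_gt0// mulrC -ler_pdivlMr ?subr_gt0//.
    by rewrite sqr_sqrtr; [rewrite ler_wpM2r|rewrite mulr_ge0].
  have -> : Q x = (h x + g * B x)%R by rewrite /h subrK.
  apply: (@le_trans _ _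
    ((1 - g) * h x ^+ 2 + g * ((1 - g) ^+ 2 * B x ^+ 2)))%R; last first.
    by rewrite lerD2l ler_wpM2l.
  rewrite -subr_ge0.
  have -> : ((1 - g) * h x ^+ 2 + g * ((1 - g) ^+ 2 * B x ^+ 2) -
     (1 - g) ^+ 2 * (h x + g * B x) ^+ 2 =
     g * (1 - g) * (h x - (1 - g) * B x) ^+ 2)%R by ring.
  by rewrite mulr_ge0 ?sqr_ge0// mulr_ge0// subr_ge0 ltW.
rewrite -ge0_integralZl ?lee_fin ?sqr_ge0//.
apply: (@le_trans _ _ (\int[mu]_x
    ((1 - g)%:E * (w x * (h x)%:E ^+ 2) + (g * (K * r))%:E * w x))).
  apply: ge0_le_integral => //.
  - by move=> x _; rewrite mule_ge0 ?lee_fin ?sqr_ge0.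
  - exact: measurable_funeM.
  - by apply: emeasurable_funD; exact: measurable_funeM.
  move=> x _; rewrite muleCA [X in _ + X]muleC [(1 - g)%:E * _]muleCA.
  rewrite -ge0_muleDr; last 2 first.
  - by rewrite mule_ge0 ?sqre_ge0// lee_fin subr_ge0 ltW.
  - by rewrite lee_fin !mulr_ge0// (le_trans ler01).
  rewrite lee_wpmul2l// !expe2 -!EFinM -EFinD lee_fin -!expr2.
  exact: pw.
have K0 : (0 <= K)%R by rewrite (le_trans ler01).
rewrite ge0_integralD//; last 4 first.
- by move=> x _; rewrite mule_ge0// lee_fin subr_ge0 ltW.
- exact: measurable_funeM.
- by move=> x _; rewrite mule_ge0// lee_fin !mulr_ge0.
- exact: measurable_funeM.
rewrite !ge0_integralZl ?lee_fin ?subr_ge0 ?(ltW g1) ?mulr_ge0//.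
rewrite w1 mule1 -/H rE -!EFinM -EFinD lee_fin.
(* Hence [(1 - g) r + g K r <= K r]. *)
have : (r <= K * r)%R by rewrite ler_peMl.
nra.
Qed.
End kernel_density.

(** * Marginal and average visitation densities *)

Section mdp.
Context {R : realType} {dS dA : measure_display}.
Context {S : measurableType dS} {A : measurableType dA}.
Context (muS : {sigma_finite_measure set S -> \bar R}).
Context (muA : {sigma_finite_measure set A -> \bar R}).
Local Open Scope ereal_scope.

(** The exhausting sequences are taken increasing so that the diagonal rectangles cover: a point of
    [F m] times [G n] lies in the rectangle of index [maxn m n]. *)
Lemma sigma_finite_muSA : sigma_finite setT (muSA muS muA).
Proof.
have /sigma_finiteP[F [FT Fnd Foo]] := sigma_finiteT muS.
have /sigma_finiteP[G [GT Gnd Goo]] := sigma_finiteT muA.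
exists (fun n => F n `*` G n)%classic.
  apply/esym/seteqP; split=> // -[s a] _.
  have [m _ Fs] : (\bigcup_n F n)%classic s by rewrite -FT.
  have [n _ Ga] : (\bigcup_n G n)%classic a by rewrite -GT.
  exists (maxn m n) => //; split => /=.
    by move: Fs; apply/subsetPset/Fnd/leq_maxl.
  by move: Ga; apply/subsetPset/Gnd/leq_maxr.
move=> n; have [[mF Fn] [mG Gn]] := (Foo n, Goo n).
split; first exact: measurableX.
by rewrite /muSA product_measure1E// lte_mul_pinfty// ge0_fin_numE.
Qed.

(* On a bare product [muS \x muA], inference of a sigma-finite structure picks
   the library instance for subprobabilities and fails. *)
HB.instance Definition _ := Measure.copy (muSA muS muA) (muS \x muA)%E.
HB.instance Definition _ :=
  @Measure_isSigmaFinite.Build _ _ _ (muSA muS muA) sigma_finite_muSA.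
Lemma measurable_policy (pi : S -> A -> R) (s : S) :
  is_policy muA pi -> measurable_fun setT (pi s).
Proof.
by case=> mpi _; exact: (measurable_fun_pair2 (f := fun z => pi z.1 z.2)).
Qed.

Lemma measurable_transition (q : S -> A -> S -> R) (z : S * A) :
  is_transition muS q -> measurable_fun setT (q z.1 z.2).
Proof.
case=> mq _.
exact: (measurable_fun_pair2 (f := fun x : (S * A) * S => q x.1.1 x.1.2 x.2) z).
Qed.

(** By Tonelli the action is integrated first, and the policy has mass 1 at each state. *)
Lemma integral_policy (pi : S -> A -> R) (r : S -> \bar R) :
  is_policy muA pi -> measurable_fun setT r -> (forall s, 0 <= r s) ->
  \int[muSA muS muA]_z (r z.1 * (pi z.1 z.2)%:E) = \int[muS]_s r s.
Proof.
move=> ppi mr r0; have [mpi pi1] := ppi.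
rewrite /muSA fubini_tonelli1.
- apply: eq_integral => s _; rewrite /fubini_F/=.
  rewrite ge0_integralZl ?(pi1 s).2 ?mule1//.
  + by apply/measurable_EFinP; exact: measurable_policy.
  + by move=> a _; rewrite lee_fin; exact: (pi1 s).1.
- by apply: emeasurable_funM; [exact: measurableT_comp|exact/measurable_EFinP].
- by move=> z; rewrite mule_ge0// lee_fin; exact: (pi1 z.1).1.
Qed.

Lemma marg_density (rho : S -> R) (q : S -> A -> S -> R) (pib : S -> A -> R)
    (t : nat) :
  is_state_density muS rho -> is_transition muS q -> is_policy muA pib ->
  [/\ measurable_fun setT (marg muS muA rho q pib t),
      forall z, 0 <= marg muS muA rho q pib t z &
      \int[muSA muS muA]_z marg muS muA rho q pib t z = 1].
Proof.
move=> [mrho [rho0 rho1]] tq ppib; have [mq q1] := tq; have [mpib pib1] := ppib.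
have mpE : measurable_fun setT (fun z : S * A => (pib z.1 z.2)%:E).
  exact/measurable_EFinP.
elim: t => [|t [mm m0 m1]] /=.
  split.
  - apply/measurable_EFinP; apply: measurable_funM => //.
    exact: measurableT_comp.
  - by move=> z; rewrite lee_fin mulr_ge0//; exact: (pib1 z.1).1.
  - rewrite -rho1 -(integral_policy pib (EFin \o rho)) => //.
    exact/measurable_EFinP.
pose f (x : (S * A) * S) :=
  marg muS muA rho q pib t x.1 * (q x.1.1 x.1.2 x.2)%:E.
have mf : measurable_fun setT f.
  by apply: emeasurable_funM; [exact: measurableT_comp|exact/measurable_EFinP].
have f0 x : 0 <= f x.
  by rewrite mule_ge0// lee_fin; exact: (q1 x.1.1 x.1.2).1.
(* The density of the next state. Swapping integrals shows that it has mass 1, as [q] has mass 1 in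
   its last argument. *)
pose r s :=
  \int[muSA muS muA]_y (marg muS muA rho q pib t y * (q y.1 y.2 s)%:E).
have mr : measurable_fun setT r.
  exact: (measurable_fun_fubini_tonelli_G (m1 := muSA muS muA) f mf f0).
have r0 s : 0 <= r s by apply: integral_ge0 => y _; exact: (f0 (y, s)).
split.
- apply: (emeasurable_funM _ mpE); exact: (measurableT_comp mr measurable_fst).
- move=> z; apply: mule_ge0; first exact: r0.
  by rewrite lee_fin; exact: (pib1 z.1).1.
rewrite (integral_policy pib r)//.
rewrite -m1 -(fubini_tonelli (m1 := muSA muS muA) (m2 := muS) f)//.
apply: eq_integral => y _; rewrite /f/= ge0_integralZl//.
- by rewrite (q1 y.1 y.2).2 mule1.
- by apply/measurable_EFinP; exact: measurable_transition.
- by move=> s _; rewrite lee_fin; exact: (q1 y.1 y.2).1.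
Qed.

Lemma dbar_density (rho : S -> R) (q : S -> A -> S -> R) (pib : S -> A -> R)
    (T : nat) : (0 < T)%N ->
  is_state_density muS rho -> is_transition muS q -> is_policy muA pib ->
  measurable_fun setT (dbar muS muA rho q pib T) /\
  \int[muSA muS muA]_z dbar muS muA rho q pib T z = 1.
Proof.
move=> T0 srho tq ppib.
have md t := marg_density rho q pib t srho tq ppib.
have mm t : measurable_fun setT (marg muS muA rho q pib t) by case: (md t).
have m0 t z : 0 <= marg muS muA rho q pib t z by case: (md t).
have msum : measurable_fun setT
    (fun z => \sum_(t < T) marg muS muA rho q pib t z).
  exact: emeasurable_sum.
split; first exact: measurable_funeM.
rewrite /dbar ge0_integralZl//; last first.
  by move=> z _; exact: sume_ge0.
rewrite ge0_integral_sum//.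
rewrite (eq_bigr (fun=> 1%:E)) => [|t _]; last by case: (md t).
by rewrite sumEFin sumr_const card_ord -EFinM mulVf// pnatr_eq0 -lt0n.
Qed.

End mdp.

(** For real [y = b] the gap is [(a + b)^2]; for infinite [y] the right side is [+oo]. Infinite
    values must be allowed because the policy average of [Q] can be infinite at some states. *)
Lemma sqreB_le {R : realType} (a : R) (y : \bar R) :
  ((a%:E - y) ^+ 2 <= (2 * a ^+ 2)%:E + 2%:E * y ^+ 2)%E.
Proof.
case: y => [b| |]; rewrite !expe2 /= ?mulyy ?mulNyNy.
- rewrite -EFinB -!EFinM -EFinD lee_fin -subr_ge0.
  have -> : 2 * a ^+ 2 + 2 * (b * b) - (a - b) * (a - b) = (a + b) ^+ 2 by ring.
  exact: sqr_ge0.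
- by rewrite gt0_muley ?lte_fin// addey// leey.
- by rewrite gt0_muley ?lte_fin// addey// leey.
Qed.

(** * The operators [h^pi] and [T] *)

Section hpi.
Context {R : realType} {dS dA : measure_display}.
Context {S : measurableType dS} {A : measurableType dA}.
Context (muS : {sigma_finite_measure set S -> \bar R}).
Context (muA : {sigma_finite_measure set A -> \bar R}).
Context (q : S -> A -> S -> R) (pi : S -> A -> R) (gamma : R).
Context (tq : is_transition muS q) (ppi : is_policy muA pi).
Context (gamma01 : 0 <= gamma < 1).
Local Open Scope ereal_scope.

(** This is [q^pi], uncurried so that [kernel_avg] applies to it. *)
Definition sa_kernel (z : (S * A) * (S * A)) : R :=
  (q z.1.1 z.1.2 z.2.1 * pi z.2.1 z.2.2)%R.

Lemma measurable_sa_kernel : measurable_fun setT sa_kernel.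
Proof.
have [mq _] := tq; have [mpi _] := ppi; apply: measurable_funM.
  apply: (measurableT_comp mq (g := fun z : (S * A) * (S * A) => (z.1, z.2.1))).
  apply: measurable_fun_pair; first exact: measurable_fst.
  exact: (measurableT_comp measurable_fst measurable_snd).
exact: (measurableT_comp mpi measurable_snd).
Qed.

Lemma sa_kernel_ge0 z : (0 <= sa_kernel z)%R.
Proof. by rewrite mulr_ge0//; [exact: (tq.2 _ _).1|exact: (ppi.2 _).1]. Qed.

Lemma integral_sa_kernel z : \int[muSA muS muA]_y (sa_kernel (z, y))%:E = 1.
Proof.
rewrite -(tq.2 z.1 z.2).2.
rewrite -(integral_policy muS muA pi (fun s => (q z.1 z.2 s)%:E))//.
- by apply/measurable_EFinP; exact: (measurable_transition muS).
- by move=> s; rewrite lee_fin; exact: (tq.2 _ _).1.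
Qed.

Lemma measurable_hpi Q : measurable_fun setT Q ->
  measurable_fun setT (hpi muA pi gamma Q).
Proof.
move=> mQ.
have mV : measurable_fun setT (fun s => \int[muA]_a (pi s a * Q (s, a))%:E).
  apply: (measurable_integral_section muA (fun z => (pi z.1 z.2 * Q z)%:E)).
  by apply/measurable_EFinP; apply: measurable_funM => //; case: ppi.
apply: emeasurable_funB.
  by apply/measurable_EFinP; exact: (measurableT_comp mQ measurable_fst).
by apply: measurable_funeM; exact: (measurableT_comp mV measurable_snd).
Qed.

(** The identity is needed at every [s], including those where [Q (s, .)] is not integrable under
    the policy, hence the use of [integralZl_nneg]. *)
Lemma transition_policy_integral Q z s : measurable_fun setT Q ->
  (q z.1 z.2 s)%:E * \int[muA]_a (pi s a * Q (s, a))%:E =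
  \int[muA]_a (sa_kernel (z, (s, a)) * Q (s, a))%:E.
Proof.
move=> mQ; rewrite -integralZl_nneg//.
- by apply: eq_integral => a _; rewrite -EFinM mulrA.
- exact: (tq.2 _ _).1.
- apply/measurable_EFinP; apply: measurable_funM.
    exact: (measurable_policy muA).
  exact: measurable_fun_pair2.
Qed.

(** Distribute [q] over the difference, then merge the state and action integrals by Fubini into one
    average against [q^pi]. *)
Lemma Top_hpi Q z : measurable_fun setT Q ->
  (muSA muS muA).-integrable setT (fun y => (sa_kernel (z, y) * Q y)%:E) ->
  Top muS q (hpi muA pi gamma Q) z =
  (Q z - gamma * fine (kernel_avg (muSA muS muA) sa_kernel Q z))%:E.
Proof.
move=> mQ iQ.
have avgE : kernel_avg (muSA muS muA) sa_kernel Q z \is a fin_num.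
  exact: integrable_fin_num.
have mqz : measurable_fun setT (q z.1 z.2).
  exact: (measurable_transition muS).
have iq : muS.-integrable setT (fun s => (q z.1 z.2 s)%:E).
  apply/integrableP; split; first exact/measurable_EFinP.
  under eq_integral do rewrite gee0_abs ?lee_fin ?(tq.2 _ _).1//.
  by rewrite (tq.2 _ _).2 ltry.
have iF : muS.-integrable setT
    (fun s => \int[muA]_a (sa_kernel (z, (s, a)) * Q (s, a))%:E).
  exact: (integrable_fubini_F iQ).
transitivity (\int[muS]_s ((Q z)%:E * (q z.1 z.2 s)%:E -
    gamma%:E * \int[muA]_a (sa_kernel (z, (s, a)) * Q (s, a))%:E)).
  (* Finiteness of [Q z] justifies distributing even where the inner integral is infinite. *)
  apply: eq_integral => s _; rewrite /hpi/= muleBr ?fin_num_adde_defr//.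
  by rewrite [LHS]/= muleC muleCA transition_policy_integral.
rewrite integralB//; last 2 first.
- exact: integrableZl.
- exact: integrableZl.
rewrite !integralZl// (tq.2 _ _).2 mule1 EFinB EFinM fineK//.
by congr (_ - _ * _); exact: (integral12_prod_meas1 iQ).
Qed.

Lemma Top_sqr_le f z : measurable_fun setT f ->
  Top muS q f z ^+ 2 <= \int[muS]_s ((q z.1 z.2 s)%:E * f (z, s) ^+ 2).
Proof.
move=> mf; apply: (sqr_integral_density_le muS (q z.1 z.2) (fun s => f (z, s))).
- exact: (measurable_transition muS).
- exact: (tq.2 _ _).1.
- exact: (tq.2 _ _).2.
- exact: measurable_fun_pair2.
Qed.

(** * Norm inequalities for a probability weight bounded below *)

Section weighted.
Context (w : S * A -> \bar R) (lo p K : R).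
Context (mw : measurable_fun setT w).
Context (w1 : \int[muSA muS muA]_z w z = 1).
Context (lo0 : (0 < lo)%R) (low : forall z, lo%:E <= w z).
Context (kp : forall s a s' a', (q s a s' * pi s' a' <= p)%R).
Context (K1 : (1 <= K)%R) (pK : (p / lo <= K)%R).

Let w0 z : 0 <= w z.
Proof. by apply: le_trans (low z); rewrite lee_fin ltW. Qed.

Let kp' z : (sa_kernel z <= p)%R. Proof. exact: kp. Qed.

Let K0 : (0 <= K)%R. Proof. exact: le_trans ler01 K1. Qed.

Lemma integrable_sa_kernel Q z : L2_SA muS muA w Q ->
  (muSA muS muA).-integrable setT (fun y => (sa_kernel (z, y) * Q y)%:E).
Proof.
move=> [mQ Qoo].
apply: (@integrable_kernel_avg _ _ _ (muSA muS muA) _ w lo p) => //.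
- exact: measurable_sa_kernel.
- exact: sa_kernel_ge0.
- exact: integral_sa_kernel.
Qed.

Lemma norm_Top_ge Q : L2_SA muS muA w Q ->
  (Num.sqrt K^-1 * (1 - gamma))%:E * norm_SA muS muA w (fun z => (Q z)%:E) <=
  norm_SA muS muA w (Top muS q (hpi muA pi gamma Q)).
Proof.
move=> LQ; have [mQ Qoo] := LQ; have /andP[g0 g1] := gamma01.
have Kp : (0 < K)%R by exact: lt_le_trans ltr01 K1.
have I0 : 0 <= \int[muSA muS muA]_z (w z * (Q z)%:E ^+ 2).
  by apply: integral_ge0 => z _; rewrite mule_ge0 ?sqre_ge0.
have c0 : (0 <= K^-1 * (1 - gamma) ^+ 2)%R.
  by rewrite mulr_ge0 ?sqr_ge0// invr_ge0.
(* With the constant written as a square root, monotonicity reduces the claim to the squared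
   inequality [resolvent_bound]. *)
have -> : (Num.sqrt K^-1 * (1 - gamma))%:E = sqrte (K^-1 * (1 - gamma) ^+ 2)%:E.
  rewrite /= sqrtrM ?invr_ge0// sqrtr_sqr ger0_norm// subr_ge0; exact: ltW.
rewrite -sqrteM ?lee_fin// lee_sqrt; last first.
  by apply: integral_ge0 => z _; rewrite mule_ge0 ?sqre_ge0.
rewrite EFinM -muleA lee_pdivrMl//.
rewrite [X in _ <= _ * X](eq_integral (fun z => w z *
    (Q z - gamma * fine (kernel_avg (muSA muS muA) sa_kernel Q z))%:E ^+ 2)).
  apply: (@resolvent_bound _ _ _ (muSA muS muA) sa_kernel w lo p) => //.
  - exact: measurable_sa_kernel.
  - exact: sa_kernel_ge0.
  - exact: integral_sa_kernel.
by move=> z _; rewrite Top_hpi//; exact: integrable_sa_kernel.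
Qed.

Lemma measurable_norm_SAS_inner f : measurable_fun setT f ->
  measurable_fun setT (fun z => \int[muS]_s ((q z.1 z.2 s)%:E * f (z, s) ^+ 2)).
Proof.
move=> mf; apply: (measurable_integral_section muS
  (fun x => (q x.1.1 x.1.2 x.2)%:E * f (x.1, x.2) ^+ 2)).
apply: emeasurable_funM; first by apply/measurable_EFinP; case: tq.
apply: measurable_sqre; rewrite (_ : (fun x => f (x.1, x.2)) = f)//.
by apply/funext => -[].
Qed.

Lemma norm_Top_le Q : L2_SA muS muA w Q ->
  norm_SA muS muA w (Top muS q (hpi muA pi gamma Q)) <=
  norm_SAS muS muA w q (hpi muA pi gamma Q).
Proof.
move=> LQ; have [mQ Qoo] := LQ.
have mh := measurable_hpi _ mQ.
have in0 z : 0 <= \int[muS]_s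
    ((q z.1 z.2 s)%:E * hpi muA pi gamma Q (z, s) ^+ 2).
  apply: integral_ge0 => s _; rewrite mule_ge0 ?sqre_ge0// lee_fin.
  exact: (tq.2 _ _).1.
rewrite /norm_SA /norm_SAS lee_sqrt; last first.
  by apply: integral_ge0 => z _; rewrite mule_ge0.
apply: ge0_le_integral => //.
- by move=> z _; rewrite mule_ge0 ?sqre_ge0.
- apply: emeasurable_funM => //; apply: measurable_sqre.
  (* Measurability is read off from the closed form of [Top_hpi]. *)
  rewrite (_ : Top _ _ _ = fun z =>
      (Q z - gamma * fine (kernel_avg (muSA muS muA) sa_kernel Q z))%:E).
    apply/measurable_EFinP; apply: measurable_funB => //.
    apply: measurable_funM => //.
    apply: measurableT_comp => //.
    apply: measurable_kernel_avg => //; exact: measurable_sa_kernel.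
  by apply/funext => z; apply: Top_hpi => //; exact: integrable_sa_kernel.
- by apply: emeasurable_funM => //; exact: measurable_norm_SAS_inner.
- by move=> z _; rewrite lee_wpmul2l//; exact: Top_sqr_le.
Qed.

(** Split the square with [sqreB_le]. The [Q] term contributes twice the squared norm [I]; the
    policy average contributes at most [2 gamma^2 K I] for every starting pair, and this is
    preserved on integrating against [w], of mass 1. *)
Lemma norm_hpi_le Q : L2_SA muS muA w Q ->
  norm_SAS muS muA w q (hpi muA pi gamma Q) <=
  (Num.sqrt (2 * (1 + K * gamma ^+ 2)))%:E *
    norm_SA muS muA w (fun z => (Q z)%:E).
Proof.
move=> LQ; have [mQ Qoo] := LQ.
have mQE : measurable_fun setT (fun z => (Q z)%:E) by exact/measurable_EFinP.
have mQ2 : measurable_fun setT (fun z => (Q z)%:E ^+ 2).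
  exact: measurable_sqre.
have mh := measurable_hpi _ mQ.
pose V s := \int[muA]_a (pi s a * Q (s, a))%:E.
have mV : measurable_fun setT V.
  apply: (measurable_integral_section muA (fun z => (pi z.1 z.2 * Q z)%:E)).
  by apply/measurable_EFinP; apply: measurable_funM => //; case: ppi.
pose I := \int[muSA muS muA]_z (w z * (Q z)%:E ^+ 2).
have I0 : 0 <= I by apply: integral_ge0 => z _; rewrite mule_ge0 ?sqre_ge0.
(* Jensen for the policy at each [s] moves the square inside; Tonelli then gives an integral against
   [q^pi], to which the change of measure applies. *)
have qV2 z : \int[muS]_s ((q z.1 z.2 s)%:E * V s ^+ 2) <= K%:E * I.
  apply: (@le_trans _ _ (\int[muSA muS muA]_y
      ((sa_kernel (z, y))%:E * (Q y)%:E ^+ 2))); last first.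
    apply: (@le_trans _ _ ((p / lo)%:E * I)); last first.
      by rewrite lee_wpmul2r ?lee_fin.
    apply: integral_kernel_le => //.
    + exact: measurable_sa_kernel.
    + exact: sa_kernel_ge0.
    + by move=> y; exact: sqre_ge0.
  rewrite /muSA fubini_tonelli1; last 2 first.
  - apply: emeasurable_funM => //; apply/measurable_EFinP.
    apply: measurable_fun_pair2; exact: measurable_sa_kernel.
  - by move=> y; rewrite mule_ge0 ?sqre_ge0 ?lee_fin ?sa_kernel_ge0.
  have mkQ : measurable_fun setT
      (fun y => (sa_kernel (z, y))%:E * (Q y)%:E ^+ 2).
    apply: emeasurable_funM => //; apply/measurable_EFinP.
    apply: measurable_fun_pair2; exact: measurable_sa_kernel.
  have kQ0 y : 0 <= (sa_kernel (z, y))%:E * (Q y)%:E ^+ 2.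
    by rewrite mule_ge0 ?sqre_ge0 ?lee_fin ?sa_kernel_ge0.
  apply: ge0_le_integral => //.
  - by move=> s _; rewrite mule_ge0 ?sqre_ge0 ?lee_fin ?(tq.2 _ _).1.
  - apply: emeasurable_funM; last exact: measurable_sqre.
    by apply/measurable_EFinP; exact: (measurable_transition muS).
  - exact: (measurable_fun_fubini_tonelli_F (m2 := muA) _ mkQ kQ0).
  move=> s _; have [pi0 pi1] := ppi.2 s.
  have mpi := measurable_policy muA _ s ppi.
  have mQs : measurable_fun setT (fun a => (Q (s, a))%:E).
    exact: (measurable_fun_pair2 (f := fun z => (Q z)%:E) s mQE).
  apply: (@le_trans _ _ ((q z.1 z.2 s)%:E *
      \int[muA]_a ((pi s a)%:E * (Q (s, a))%:E ^+ 2))).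
    rewrite lee_wpmul2l ?lee_fin ?(tq.2 _ _).1//.
    exact: (sqr_integral_density_le muA (pi s) (fun a => (Q (s, a))%:E)).
  rewrite -ge0_integralZl//; last 3 first.
  - by apply: emeasurable_funM; [exact/measurable_EFinP|exact: measurable_sqre].
  - by move=> a _; rewrite mule_ge0 ?sqre_ge0 ?lee_fin.
  - by rewrite lee_fin (tq.2 _ _).1.
  rewrite le_eqVlt; apply/orP; left; apply/eqP; apply: eq_integral => a _.
  by rewrite muleA.
have inner z :
    \int[muS]_s ((q z.1 z.2 s)%:E * hpi muA pi gamma Q (z, s) ^+ 2) <=
    (2 * Q z ^+ 2)%:E + (2 * gamma ^+ 2)%:E * (K%:E * I).
  have mqz : measurable_fun setT (fun s => (q z.1 z.2 s)%:E).
    by apply/measurable_EFinP; exact: (measurable_transition muS).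
  have q0 s : 0 <= (q z.1 z.2 s)%:E by rewrite lee_fin (tq.2 _ _).1.
  have mqV : measurable_fun setT (fun s => (q z.1 z.2 s)%:E * V s ^+ 2).
    by apply: emeasurable_funM => //; exact: measurable_sqre.
  have qV0 s : 0 <= (q z.1 z.2 s)%:E * V s ^+ 2 by rewrite mule_ge0 ?sqre_ge0.
  have c0 : 0 <= (2 * gamma ^+ 2)%:E by rewrite lee_fin mulr_ge0 ?sqr_ge0.
  have d0 : 0 <= (2 * Q z ^+ 2)%:E by rewrite lee_fin mulr_ge0 ?sqr_ge0.
  apply: (@le_trans _ _ (\int[muS]_s ((2 * Q z ^+ 2)%:E * (q z.1 z.2 s)%:E +
      (2 * gamma ^+ 2)%:E * ((q z.1 z.2 s)%:E * V s ^+ 2)))).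
    apply: ge0_le_integral => //.
    - by move=> s _; rewrite mule_ge0 ?sqre_ge0.
    - apply: emeasurable_funM => //; apply: measurable_sqre.
      exact: (measurable_fun_pair2 z mh).
    - by apply: emeasurable_funD; exact: measurable_funeM.
    move=> s _; rewrite [_%:E * (q _ _ _)%:E]muleC [X in _ + X]muleCA.
    rewrite -ge0_muleDr//; last by rewrite mule_ge0 ?sqre_ge0.
    rewrite lee_wpmul2l//.
    rewrite (_ : hpi _ _ _ _ _ = (Q z)%:E - gamma%:E * V s)//.
    rewrite (le_trans (sqreB_le _ _))// leeD2l//.
    by rewrite !expe2 muleACA -EFinM -expr2 (muleA 2%:E) -EFinM.
  rewrite ge0_integralD//; last 4 first.
  - by move=> s _; rewrite mule_ge0.
  - exact: measurable_funeM.
  - by move=> s _; rewrite mule_ge0.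
  - exact: measurable_funeM.
  rewrite !ge0_integralZl// (tq.2 _ _).2 mule1 leeD2l//.
  by rewrite lee_wpmul2l.
rewrite /norm_SAS /norm_SA -/I.
have c0 : (0 <= 2 * (1 + K * gamma ^+ 2))%R.
  by rewrite mulr_ge0// addr_ge0// mulr_ge0// sqr_ge0.
rewrite (_ : (Num.sqrt _)%:E = sqrte (2 * (1 + K * gamma ^+ 2))%:E)//.
rewrite -sqrteM ?lee_fin// lee_sqrt; last by rewrite mule_ge0.
have [r rE] : exists r, I = r%:E.
  by exists (fine I); rewrite fineK// ge0_fin_numE.
have r0 : (0 <= r)%R by rewrite -lee_fin -rE.
have in0 z : 0 <= \int[muS]_s
    ((q z.1 z.2 s)%:E * hpi muA pi gamma Q (z, s) ^+ 2).
  apply: integral_ge0 => s _; rewrite mule_ge0 ?sqre_ge0// lee_fin.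
  exact: (tq.2 _ _).1.
have mwQ2 : measurable_fun setT (fun z => w z * (Q z)%:E ^+ 2).
  exact: emeasurable_funM.
have c2 : 0 <= (2 * gamma ^+ 2 * (K * r))%:E.
  rewrite lee_fin; apply: mulr_ge0; last exact: mulr_ge0.
  by rewrite mulr_ge0 ?sqr_ge0.
have wQ0 z : 0 <= w z * (Q z)%:E ^+ 2 by rewrite mule_ge0 ?sqre_ge0.
apply: (@le_trans _ _ (\int[muSA muS muA]_z (2%:E * (w z * (Q z)%:E ^+ 2) +
    (2 * gamma ^+ 2 * (K * r))%:E * w z))).
  apply: ge0_le_integral => //.
  - by move=> z _; rewrite mule_ge0.
  - by apply: emeasurable_funM => //; exact: measurable_norm_SAS_inner.
  - by apply: emeasurable_funD; exact: measurable_funeM.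
  move=> z _; rewrite muleCA [X in _ + X]muleC -ge0_muleDr//; last first.
    by rewrite mule_ge0 ?sqre_ge0.
  rewrite lee_wpmul2l// (le_trans (inner z))// rE expe2 -!EFinM.
  by rewrite expr2.
rewrite ge0_integralD//; last 4 first.
- by move=> z _; rewrite mule_ge0.
- exact: measurable_funeM.
- by move=> z _; rewrite mule_ge0.
- exact: measurable_funeM.
rewrite !ge0_integralZl// w1 mule1 -/I rE -!EFinM -EFinD lee_fin.
by rewrite le_eqVlt; apply/orP; left; apply/eqP; ring.
Qed.

End weighted.
End hpi.

(** * Quotients of norms and the shape of the constant *)

Lemma ediv_le {R : realType} {a b : R} {N D n : \bar R} :
  0 <= a -> 0 < b -> (0 <= N)%E -> (0 <= n)%E -> (n < +oo)%E ->
  (N <= a%:E * n)%E -> (b%:E * n <= D)%E -> (N / D <= (a / b)%:E)%E.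
Proof.
move=> a0 b0 N0; case: n => [n| |]//; rewrite lee_fin => n0 _ Nn nD.
have ab0 : 0 <= a / b by rewrite divr_ge0// ltW.
(* An infinite denominator has inverse 0. *)
case: D nD => [D| |]//=; last by rewrite invey mule0 lee_fin.
rewrite -!EFinM lee_fin => nD; case: N N0 Nn => [N| |]//.
rewrite -!EFinM !lee_fin => N0 Nn; rewrite inver; case: eqP => D0.
  (* A zero denominator has inverse [+oo], but it forces [n = 0] and then [N = 0], so the quotient
     is [0 * +oo = 0]. This covers [Q = 0] in the supremum. *)
  have n00 : n = 0.
    apply/eqP; rewrite eq_le n0 andbT -(pmulr_rle0 _ b0).
    by rewrite (le_trans nD)// D0.
  by rewrite n00 mulr0 in Nn; rewrite (@le_anti _ _ N 0) ?Nn// mul0e lee_fin.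
have Dp : 0 < D.
  rewrite lt_neqAle eq_sym; apply/andP; split; first exact/eqP.
  exact: le_trans (mulr_ge0 (ltW b0) n0) nD.
rewrite -EFinM lee_fin ler_pdivrMr// (le_trans Nn)// -mulrA ler_wpM2l//.
by rewrite mulrC ler_pdivlMr// mulrC.
Qed.

(** The right side is the constant of [norm_hpi_le] over that of [Top_lower_bound], at [K = P / p];
    the left side is the required form with [C = sqrt 2]. *)
Lemma sqrt_ratioE {R : rcfType} (P p g : R) : 0 < P -> 0 < p -> g < 1 ->
  Num.sqrt 2 * (Num.sqrt (P * (1 + P * g ^+ 2 / p)) / (Num.sqrt p * (1 - g))) =
  Num.sqrt (2 * (1 + P / p * g ^+ 2)) / (Num.sqrt (p / P) * (1 - g)).
Proof.
move=> P0 p0 g1.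
rewrite (mulrAC P) (sqrtrM _ (ltW P0)) (@sqrtrM _ 2)// (sqrtrM _ (ltW p0)).
rewrite sqrtrV ?(ltW P0)//.
have : Num.sqrt p != 0 by rewrite gt_eqF// sqrtr_gt0.
have : Num.sqrt P != 0 by rewrite gt_eqF// sqrtr_gt0.
have : 1 - g != 0 by rewrite gt_eqF// subr_gt0.
move: (Num.sqrt p) (Num.sqrt P) (Num.sqrt 2) (Num.sqrt (1 + _)) => x y z t.
by move=> h1 h2 h3; field; rewrite h1 h2.
Qed.

(** * Specialization to the average visitation density *)

Section MDP_assumptions_consequences.
Context {R : realType} {dS dA : measure_display}.
Context {S : measurableType dS} {A : measurableType dA}.
Context (muS : {sigma_finite_measure set S -> \bar R}).
Context (muA : {sigma_finite_measure set A -> \bar R}).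

Lemma L2_SAB (w : S * A -> \bar R) (Q1 Q2 : S * A -> R) :
  measurable_fun setT w -> (forall z, 0 <= w z)%E ->
  L2_SA muS muA w Q1 -> L2_SA muS muA w Q2 ->
  L2_SA muS muA w (fun z => Q1 z - Q2 z).
Proof.
move=> mw w0 [m1 f1] [m2 f2]; split; first exact: measurable_funB.
have mE (Q : S * A -> R) : measurable_fun setT Q ->
    measurable_fun setT (fun z => w z * (Q z)%:E ^+ 2)%E.
  move=> mQ; apply: emeasurable_funM => //.
  by apply: measurable_sqre; exact/measurable_EFinP.
have E0 (Q : S * A -> R) z : (0 <= w z * (Q z)%:E ^+ 2)%E.
  by rewrite mule_ge0 ?sqre_ge0.
apply: (@le_lt_trans _ _ (\int[muSA muS muA]_z
    (2%:E * (w z * (Q1 z)%:E ^+ 2) + 2%:E * (w z * (Q2 z)%:E ^+ 2)))%E).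
  apply: ge0_le_integral => //.
  - by move=> z _; rewrite mule_ge0 ?sqre_ge0.
  - apply: (mE (fun z => Q1 z - Q2 z)); exact: measurable_funB.
  - apply: emeasurable_funD; apply: measurable_funeM.
      exact: (mE _ m1).
    exact: (mE _ m2).
  move=> z _; rewrite ![(2%:E * (w z * _))%E]muleCA.
  rewrite -ge0_muleDr; last 2 first.
  - exact: mule_ge0 (sqre_ge0 _).
  - exact: mule_ge0 (sqre_ge0 _).
  rewrite lee_wpmul2l//.
  by rewrite EFinB (le_trans (sqreB_le _ _))// EFinM EFin_expe.
rewrite ge0_integralD//; last 4 first.
- by move=> z _; rewrite mule_ge0.
- by apply: measurable_funeM; exact: (mE _ m1).
- by move=> z _; rewrite mule_ge0.
- by apply: measurable_funeM; exact: (mE _ m2).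
rewrite !ge0_integralZl//; [|exact: (mE _ m2)|exact: (mE _ m1)].
by rewrite lte_add_pinfty// lte_mul_pinfty.
Qed.

Context (rho : S -> R) (q : S -> A -> S -> R) (pi pib : S -> A -> R) (T : nat).
Context (gamma pmin p1max p2max : R).
Context (H : MDP_assumptions muS muA rho q pi pib T gamma pmin p1max p2max).
Let pmax := Num.max p1max p2max.
Let w := dbar muS muA rho q pib T.

Lemma measurable_dbar : measurable_fun setT w.
Proof.
by case: H => -[_ T0] [? ? _ ?] _ _ _; case: (dbar_density muS muA rho q pib T).
Qed.

Lemma integral_dbar : (\int[muSA muS muA]_z w z = 1)%E.
Proof.
by case: H => -[_ T0] [? ? _ ?] _ _ _; case: (dbar_density muS muA rho q pib T).
Qed.

(** Mass 1 yields a point [z], where [pmin <= w z <= p1max <= pmax]. *)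
Lemma ratio_ge1 : 1 <= pmax / pmin.
Proof.
case: H => _ _ [pmin0 _] wb _.
have [z] : inhabited (S * A).
  apply: (inhabited_of_integral (muSA muS muA) w).
  by rewrite integral_dbar oner_neq0.
rewrite ler_pdivlMr// mul1r le_max; apply/orP; left.
by have [h1 h2] := wb z; rewrite -lee_fin (le_trans h1).
Qed.

Lemma p2max_ratio_le : p2max / pmin <= pmax / pmin.
Proof.
case: H => _ _ [pmin0 _] _ _.
by rewrite ler_pM2r ?invr_gt0// le_max lexx orbT.
Qed.

Lemma Top_lower_bound Q : L2_SA muS muA w Q ->
  ((Num.sqrt (pmin / pmax) * (1 - gamma))%:E *
    norm_SA muS muA w (fun z => (Q z)%:E)
   <= norm_SA muS muA w (Top muS q (hpi muA pi gamma Q)))%E.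
Proof.
move=> LQ; case: H => -[g01 _] [_ tq ppi _] [pmin0 _] wb [_ kp].
rewrite -invf_div.
apply: (norm_Top_ge muS muA q pi gamma tq ppi g01 w pmin p2max) => //.
- exact: measurable_dbar.
- exact: integral_dbar.
- by move=> z; case: (wb z).
- exact: ratio_ge1.
- exact: p2max_ratio_le.
Qed.

End MDP_assumptions_consequences.

Theorem theorem1 (R : realType) :
  (forall (dS dA : measure_display) (S : measurableType dS) (A : measurableType dA)
      (muS : {sigma_finite_measure set S -> \bar R})
      (muA : {sigma_finite_measure set A -> \bar R})
      (rho : S -> R) (q : S -> A -> S -> R) (pi pib : S -> A -> R) (T : nat)
      (gamma pmin p1max p2max : R),
    MDP_assumptions muS muA rho q pi pib T gamma pmin p1max p2max ->
    let pmax := Num.max p1max p2max in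
    let d := dbar muS muA rho q pib T in
    forall Q1 Q2 : S * A -> R,
      L2_SA muS muA d Q1 -> L2_SA muS muA d Q2 ->
      let Q := fun z => Q1 z - Q2 z in
      ((Num.sqrt (pmin / pmax) * (1 - gamma))%:E *
         norm_SA muS muA d (fun z => (Q z)%:E)
       <= norm_SA muS muA d (Top muS q (hpi muA pi gamma Q)))%E /\
      (norm_SA muS muA d (Top muS q (hpi muA pi gamma Q))
       <= norm_SAS muS muA d q (hpi muA pi gamma Q))%E)
  /\
  (exists C : R, 0 < C /\
    forall (dS dA : measure_display) (S : measurableType dS) (A : measurableType dA)
      (muS : {sigma_finite_measure set S -> \bar R})
      (muA : {sigma_finite_measure set A -> \bar R})
      (rho : S -> R) (q : S -> A -> S -> R) (pi pib : S -> A -> R) (T : nat)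
      (gamma pmin p1max p2max : R),
    MDP_assumptions muS muA rho q pi pib T gamma pmin p1max p2max ->
    let pmax := Num.max p1max p2max in
    (ill_posedness muS muA rho q pi pib T gamma
     <= (C * (Num.sqrt (pmax * (1 + pmax * gamma ^+ 2 / pmin))
              / (Num.sqrt pmin * (1 - gamma))))%:E)%E).

Proof.
split.
  move=> dS dA S A muS muA rho q pi pib T gamma pmin p1max p2max H pmax d Q1 Q2.
  move=> L1 L2 Q.
  have mw := measurable_dbar muS muA rho q pi pib T gamma pmin p1max p2max H.
  have [_ [_ tq ppi _] [pmin0 _] wb [_ kp]] := H.
  have w0 z : (0 <= d z)%E.
    by case: (wb z) => + _; apply: le_trans; rewrite lee_fin ltW.
  have LQ : L2_SA muS muA d Q by exact: L2_SAB.
  split; first exact: (Top_lower_bound muS muA rho q pi pib T _ _ _ _ H).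
  apply: (norm_Top_le muS muA q pi gamma tq ppi d pmin p2max) => //.
  by move=> z; case: (wb z).
(* The 2 is the factor in [sqreB_le]; the constant is the same for all decision processes. *)
exists (Num.sqrt 2); split; first by rewrite sqrtr_gt0.
move=> dS dA S A muS muA rho q pi pib T gamma pmin p1max p2max H; lazy zeta.
set pmax := Num.max p1max p2max.
have mw := measurable_dbar muS muA rho q pi pib T gamma pmin p1max p2max H.
have w1 := integral_dbar muS muA rho q pi pib T gamma pmin p1max p2max H.
have K1 := ratio_ge1 muS muA rho q pi pib T gamma pmin p1max p2max H.
have pK := p2max_ratio_le muS muA rho q pi pib T gamma pmin p1max p2max H.
have [[g01 _] [_ tq ppi _] [pmin0 [p1max0 _]] wb [_ kp]] := H.
have /andP[g0 g1] := g01.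
have pmax0 : 0 < pmax by rewrite lt_max p1max0.
have b0 : 0 < Num.sqrt (pmin / pmax) * (1 - gamma).
  by rewrite mulr_gt0 ?subr_gt0// sqrtr_gt0 divr_gt0.
apply: ub_ereal_sup => _ [Q LQ <-].
rewrite [X in (_ <= X)%E](_ : _ =
    (Num.sqrt (2 * (1 + pmax / pmin * gamma ^+ 2)) /
    (Num.sqrt (pmin / pmax) * (1 - gamma)))%:E).
  apply: (ediv_le (n := norm_SA muS muA (dbar muS muA rho q pib T)
    (fun z => (Q z)%:E))) => //.
  - exact: sqrte_ge0.
  - exact: sqrte_ge0.
  - case: LQ => _; rewrite /norm_SA.
    by case: (integral _ _ _) => [r _|//|_]; exact: ltry.
  - apply: (norm_hpi_le muS muA q pi gamma tq ppi _ pmin p2max) => //.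
    by move=> z; case: (wb z).
  - exact: (Top_lower_bound muS muA rho q pi pib T _ _ _ _ H).
by congr (_%:E); exact: sqrt_ratioE.
Qed.
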